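(* For all integers $m,n \geq 2$, $$\mathrm{gen}_{m,n}(\mathbb{Z}) \leq 2^{(m-1)n^2} \prod_{k=1}^{n} \left( 1 - 2^{-k} \right)^{-1} < 3.463 \cdot 2^{(m-1)n^2}.$$
   Context: $M_n(\mathbb{Z})^k$ is the direct sum of $k$ copies of the ring of $n\times n$ integer matrices with componentwise operations. A set $S$ generates a ring $A$ if every element of $A$ is a $\mathbb{Z}$-linear combination of nonempty products of elements of $S$ (the identity element is not automatically included). A ring ''has (admits) $m$ generators'' if it can be generated by $m$ elements. $\mathrm{gen}_{m,n}(\mathbb{Z})$ is the integer such that the ring $M_n(\mathbb{Z})^{\mathrm{gen}_{m,n}(\mathbb{Z})}$ admits $m$ generators, while $M_n(\mathbb{Z})^{1+\mathrm{gen}_{m,n}(\mathbb{Z})}$ needs at least $m+1$ generators. *)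

(* Defs.v *)
From HB Require Import structures.
From mathcomp Require Import all_boot all_order all_algebra.
From mathcomp Require Import boolp classical_sets.

Set Implicit Arguments.
Unset Strict Implicit.
Unset Printing Implicit Defensive.

Import Order.TTheory GRing.Theory Num.Theory.

Local Open Scope classical_set_scope.
Local Open Scope ring_scope.

(* A pair (z, w) in the list c stands for the term z * (product of the word w);
   words must be nonempty, so the identity does not come for free. *)
Definition generates (A : pzRingType) (S : set A) : Prop :=
  forall a : A, exists2 c : seq (int * seq A),
    (forall t, t \in c -> t.2 != [::] /\ (forall x, x \in t.2 -> S x)) &
    a = \sum_(t <- c) (\prod_(x <- t.2) x) *~ t.1.

(* The m generators are a family and need not be distinct. *)
Definition admits_generators (m : nat) (A : pzRingType) : Prop :=
  exists x : 'I_m -> A, generates (range x).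

Definition needs_at_least_generators (m : nat) (A : pzRingType) : Prop :=
  forall j : nat, admits_generators j A -> (m <= j)%N.

(* M_n(Z)^k; for k = 0 or n = 0 this is the zero ring, hence pzRingType. *)
Definition matZ_power (n k : nat) : pzRingType := {ffun 'I_k -> 'M[int]_n}.

Definition is_gen (m n g : nat) : Prop :=
  admits_generators m (matZ_power n g) /\
  needs_at_least_generators m.+1 (matZ_power n (1 + g)).

(* The integer g such that is_gen m n g; it exists and is unique for every m
   and every n > 0 by genP and gen_unique, so the default 0 is then not used. *)
Definition gen (m n : nat) : nat := xget 0%N [set g | is_gen m n g].

Lemma morph_word_sum (A B : pzRingType) (f : {rmorphism A -> B})
    (c : seq (int * seq A)) :
  f (\sum_(t <- c) (\prod_(x <- t.2) x) *~ t.1) =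
  \sum_(t <- c) (\prod_(x <- t.2) f x) *~ t.1.
Proof.
rewrite raddf_sum; apply: eq_bigr => t _.
by rewrite raddfMz /= rmorph_prod.
Qed.

Lemma generates_eq_morph (A B : pzRingType) (f g : {rmorphism A -> B})
    (S : set A) :
  generates S -> (forall x, S x -> f x = g x) -> f =1 g.
Proof.
move=> genS fg a; have [c cP ->] := genS a; rewrite !morph_word_sum.
apply: eq_big_seq => t /cP[_ tS]; congr (_ *~ _).
by apply: eq_big_seq => x /tS/fg.
Qed.

Lemma generates_sub (A : pzRingType) (S T : set A) :
  S `<=` T -> generates S -> generates T.
Proof.
move=> ST genS a; have [c cP ->] := genS a; exists c => // t /cP[? tS].
by split=> // x /tS/ST.
Qed.

Lemma generates_image (A B : pzRingType) (f : {rmorphism A -> B}) (S : set A) :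
  (forall b, exists a, f a = b) -> generates S -> generates (f @` S).
Proof.
move=> fsurj genS b; have [a <-] := fsurj b; have [c cP ->] := genS a.
exists [seq (t.1, map f t.2) | t <- c].
  move=> _ /mapP[t /cP[t0 tS] ->] /=; split; first by case: (t.2) t0.
  by move=> _ /mapP[x /tS Sx ->]; exists x.
rewrite morph_word_sum big_map; apply: eq_bigr => t _ /=.
by rewrite big_map.
Qed.

Lemma admits_generators_image (m : nat) (A B : pzRingType)
    (f : {rmorphism A -> B}) :
  (forall b, exists a, f a = b) -> admits_generators m A -> admits_generators m B.
Proof.
move=> fsurj [x genx]; exists (f \o x).
apply: generates_sub (generates_image fsurj genx).
by move=> _ [_ [i _ <-] <-]; exists i.
Qed.

Lemma admits_generators_leq (j m : nat) (A : pzRingType) :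
  (j <= m)%N -> admits_generators j A -> admits_generators m A.
Proof.
move=> jm [x genx].
exists (fun i : 'I_m => oapp x 0 (insub (val i))).
apply: generates_sub genx => _ [i _ <-]; exists (widen_ord jm i) => //=.
by rewrite valK.
Qed.

Section Restriction.
Variables (A : pzRingType) (I J : finType) (h : J -> I).

Definition ffun_restr (a : {ffun I -> A}) : {ffun J -> A} := [ffun j => a (h j)].

Fact ffun_restr_zmod : zmod_morphism ffun_restr.
Proof. by move=> a b; apply/ffunP => j; rewrite !ffunE. Qed.

Fact ffun_restr_monoid : monoid_morphism ffun_restr.
Proof. by split=> [|a b]; apply/ffunP => j; rewrite !ffunE. Qed.

HB.instance Definition _ :=
  GRing.isZmodMorphism.Build {ffun I -> A} {ffun J -> A} ffun_restr
    ffun_restr_zmod.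
HB.instance Definition _ :=
  GRing.isMonoidMorphism.Build {ffun I -> A} {ffun J -> A} ffun_restr
    ffun_restr_monoid.

End Restriction.

Section Evaluation.
Variables (n k : nat) (i : 'I_k).

Definition eval_mod2 (a : matZ_power n k) : 'M['F_2]_n :=
  map_mx (intr : int -> 'F_2) ((a : {ffun 'I_k -> 'M[int]_n}) i).

Fact eval_mod2_zmod : zmod_morphism eval_mod2.
Proof. by move=> a b; rewrite /eval_mod2 !ffunE map_mxB. Qed.

Fact eval_mod2_monoid : monoid_morphism eval_mod2.
Proof.
by split=> [|a b]; rewrite /eval_mod2 !ffunE ?map_mxM ?map_mx1.
Qed.

HB.instance Definition _ :=
  GRing.isZmodMorphism.Build (matZ_power n k) 'M['F_2]_n eval_mod2
    eval_mod2_zmod.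
HB.instance Definition _ :=
  GRing.isMonoidMorphism.Build (matZ_power n k) 'M['F_2]_n eval_mod2
    eval_mod2_monoid.

End Evaluation.

Lemma admits_matZ_power_leq (m n k l : nat) :
  (k <= l)%N -> admits_generators m (matZ_power n l) ->
  admits_generators m (matZ_power n k).
Proof.
move=> kl; apply: (admits_generators_image (f := ffun_restr (widen_ord kl))).
move=> b; exists [ffun i : 'I_l => oapp (b : {ffun _ -> _}) 0 (insub (val i))].
by apply/ffunP => i; rewrite !ffunE /= valK.
Qed.

Lemma admits_matZ_power0 (m n : nat) : admits_generators m (matZ_power n 0).
Proof.
exists (fun=> 0) => a; exists [::] => //.
by rewrite big_nil; apply/ffunP; case.
Qed.

Lemma admits_matZ_power_bound (m n k : nat) :
  (0 < n)%N -> admits_generators m (matZ_power n k) ->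
  (k <= #|{ffun 'I_m -> 'M['F_2]_n}|)%N.
Proof.
move=> n0 [x genx].
suff inj : injective (fun i : 'I_k => [ffun l : 'I_m => eval_mod2 i (x l)]).
  by have := leq_card _ inj; rewrite card_ord.
move=> i j /ffunP eq_ij; apply/eqP/negPn/negP => neq_ij.
have eqf : eval_mod2 (n := n) i =1 eval_mod2 j.
  apply: (generates_eq_morph genx) => _ [l _ <-] /=.
  by have := eq_ij l; rewrite !ffunE.
have := eqf [ffun l : 'I_k => (l == i)%:R%:M].
rewrite /eval_mod2 !ffunE eqxx eq_sym (negPf neq_ij).
move=> /matrixP/(_ (Ordinal n0) (Ordinal n0)).
by rewrite !mxE eqxx /= => /eqP.
Qed.

Lemma is_gen_unique (m n g h : nat) : is_gen m n g -> is_gen m n h -> g = h.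
Proof.
have H g' h' : is_gen m n g' -> is_gen m n h' -> (g' <= h')%N.
  move=> [ag _] [_ nh]; rewrite leqNgt; apply/negP => hg.
  by have := nh _ (admits_matZ_power_leq hg ag); rewrite ltnn.
by move=> Hg Hh; apply/eqP; rewrite eqn_leq !H.
Qed.

Lemma is_gen_exists (m n : nat) : (0 < n)%N -> exists g, is_gen m n g.
Proof.
move=> n0; pose P k := `[< admits_generators m (matZ_power n k) >].
have exP : exists k, P k by exists 0%N; apply/asboolP/admits_matZ_power0.
have ubP k : P k -> (k <= #|{ffun 'I_m -> 'M['F_2]_n}|)%N.
  by move=> /asboolP; exact: admits_matZ_power_bound.
case: (ex_maxnP exP ubP) => g /asboolP Pg maxg; exists g; split=> // j Aj.
rewrite ltnNge; apply/negP => jm.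
have /maxg : P (1 + g)%N by apply/asboolP; exact: admits_generators_leq jm Aj.
by rewrite ltnn.
Qed.

Lemma genP (m n : nat) : (0 < n)%N -> is_gen m n (gen m n).
Proof. by move=> n0; have [g Hg] := is_gen_exists m n0; apply: (xgetI _ Hg). Qed.

Lemma gen_unique (m n g : nat) : is_gen m n g -> g = gen m n.
Proof. by move=> Hg; apply: (is_gen_unique Hg); apply: (xgetI _ Hg). Qed.

(* Main.v *)
Require Import Defs.
From mathcomp Require Import all_boot all_order all_algebra.
From mathcomp Require Import ring lra.
Import Order.TTheory GRing.Theory Num.Theory.
Local Open Scope ring_scope.

(** The bound counts generating families of [M_n(Z)^k] modulo 2.

    Suppose that [x_1, ..., x_m] generate [M_n(Z)^k].  Reducing the [i]-th
    component modulo 2 is a surjective ring morphism [e_i] onto [M_n(F_2)], and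
    conjugating by [u] in [GL_n(F_2)] gives another one.  A ring morphism is
    determined by its values on generators, so the [m]-tuples
    [(u e_i(x_l) u^-1)_l] for distinct pairs [(i, u)] differ as soon as the
    morphisms differ.  They do differ: morphisms for distinct [i] are separated
    by the idempotents of the product, and for the same [i] an equality makes
    the quotient of the two units central in [M_n(F_2)], hence equal to the only
    nonzero scalar of [F_2].  Therefore [k * |GL_n(F_2)|] is at most the number
    [2 ^ (m n^2)] of [m]-tuples, and dividing by
    [|GL_n(F_2)| = 2 ^ (n^2) * \prod_(k = 1..n) (1 - 2 ^- k)] gives the first
    inequality.

    For the numerical one, put [P_n = \prod_(k = 1..n) (1 - 2 ^- k)]; the claim
    is [P_n > c] with [c = 1000/3463].  As [P_n] decreases to a positive limit
    only slightly above [c], a direct induction fails; the strengthened bound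
    [P_n >= c (1 + 2^-n + 4^-n)] is inductive and already true at [n = 7]. *)

(** The elements [a] with [w * f a = g a * w] form a subring.  For an
    invertible [w] this says that a conjugate of [f] that agrees with [g] on
    generators agrees with it everywhere, without making the conjugate into a
    morphism. *)
Lemma generates_intertwine (A B : pzRingType) (f g : {rmorphism A -> B})
    (w : B) (S : classical_sets.set A) :
  generates S -> (forall x, S x -> w * f x = g x * w) ->
  forall a, w * f a = g a * w.
Proof.
move=> genS wfg a; have [c cP ->] := genS a.
rewrite !morph_word_sum mulr_sumr mulr_suml; apply: eq_big_seq => t /cP[_ tS].
rewrite mulrzAr mulrzAl; congr (_ *~ _).
elim: t.2 tS => [|x s IHs] xsS; first by rewrite !big_nil mulr1 mul1r.
have Sx : S x by apply: xsS; rewrite mem_head.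
rewrite !big_cons mulrA (wfg x Sx) -!mulrA IHs // => y sy.
by apply: xsS; rewrite inE sy orbT.
Qed.

(** Comparing the entries [(a, 0)] of both sides at the matrix unit
    [delta_mx b 0] gives [w a b = (a == b) * w 0 0]; this is how commuting with
    all matrix units forces a matrix to be scalar. *)
Lemma central_is_scalar_mx (R : pzRingType) (n : nat) (w : 'M[R]_n) :
  (forall i j, w *m delta_mx i j = delta_mx i j *m w) -> is_scalar_mx w.
Proof.
case: n w => [|n] w wC; first by apply/is_scalar_mxP; exists 0; apply/matrixP; case.
apply/is_scalar_mxP; exists (w ord0 ord0); apply/matrixP => a b.
have /matrixP/(_ a ord0) := wC b ord0; rewrite !mxE.
rewrite (bigD1 b) //= big1 => [|k /negPf kb]; last first.
  by rewrite !mxE kb mulr0.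
rewrite (bigD1 ord0) //= big1 => [|k /negPf k0]; last first.
  by rewrite !mxE k0 andbF mul0r.
rewrite !mxE !eqxx mulr1 !addr0 andbT => ->.
by case: eqP; rewrite ?mul1r ?mul0r ?mulr1n.
Qed.

(** Killing the other components at the same time provides both the matrices
    that test centrality and the idempotents that separate the components. *)
Lemma eval_mod2_surj (n k : nat) (i : 'I_k) (b : 'M['F_2]_n) :
  exists a : matZ_power n k,
    eval_mod2 i a = b /\ forall j, j != i -> eval_mod2 j a = 0.
Proof.
exists [ffun j => if j == i then map_mx (fun z : 'F_2 => (z : nat)%:Z) b else 0].
split=> [|j /negPf ji]; rewrite /eval_mod2 ffunE ?ji ?map_mx0 // eqxx.
by apply/matrixP => r s; rewrite !mxE -pmulrn natr_Zp.
Qed.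

Section CountGenerators.
Variables (m n k : nat) (x : 'I_m -> matZ_power n.+1 k).
Hypothesis genx : generates (classical_sets.range x).

Definition conj_family (p : 'I_k * {'GL_n.+1['F_2]}) :
    {ffun 'I_m -> 'M['F_2]_n.+1} :=
  [ffun l => val p.2 * eval_mod2 p.1 (x l) / val p.2].

Lemma conj_family_inj : injective conj_family.
Proof.
move=> [i u] [j v] /ffunP eq_uv.
have uU : val u \is a GRing.unit by apply: valP u.
have vU : val v \is a GRing.unit by apply: valP v.
pose w : 'M['F_2]_n.+1 := (val v)^-1 * val u.
have wU : w \is a GRing.unit by rewrite unitrMl ?unitrV.
have wE a : w * eval_mod2 i a = eval_mod2 j a * w.
  apply: (generates_intertwine _ _ _ _ _ _ genx) => _ [l _ <-].
  have := eq_uv l; rewrite !ffunE /= => /(congr1 (fun y => (val v)^-1 * y * val u)).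
  by rewrite /w !mulrA (mulrVK uU) (mulVr vU) mul1r.
have ij : i = j.
  apply/eqP/negPn/negP => ij.
  have [a [ai aj]] := eval_mod2_surj _ _ i (1 : 'M_n.+1).
  have := wE a; rewrite ai aj 1?eq_sym // mulr1 mul0r => w0.
  by rewrite w0 unitr0 in wU.
subst j; congr pair; apply: val_inj.
have /is_scalar_mxP[c wc] : is_scalar_mx w.
  apply: central_is_scalar_mx => r s.
  have [a [ai _]] := eval_mod2_surj _ _ i (delta_mx r s : 'M_n.+1).
  by have := wE a; rewrite ai.
(* The only nonzero scalar of F_2 is 1. *)
have c1 : c = 1.
  apply/eqP; case: c wc => [[|[|//]] ci] wc //.
  suff w0 : w = 0 by rewrite w0 unitr0 in wU.
  by rewrite wc (_ : Ordinal ci = 0) ?raddf0 //; apply: val_inj.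
by rewrite -[LHS](mulVKr vU) -/w wc c1 mulr1.
Qed.

End CountGenerators.

Lemma admits_matZ_power_GL_bound (m n k : nat) :
  admits_generators m (matZ_power n.+1 k) ->
  (k * #|'GL_n.+1['F_2]%g| <= 2 ^ (m * n.+1 ^ 2))%N.
Proof.
move=> [x genx]; have := leq_card _ (conj_family_inj _ _ _ _ genx).
rewrite card_prod card_ord cardsT card_ffun card_mx card_Fp // card_ord.
by rewrite -expnM mulnn [(_ ^ 2 * m)%N]mulnC.
Qed.

(** The factor [2 ^ 'C(n, 2)] in the order of the linear group is what remains of
    [2 ^ (n ^ 2)] once [2 ^ k] is factored out of each [2 ^ k - 1]. *)
Lemma card_GL2_natr (n : nat) :
  #|'GL_n.+1['F_2]%g|%:R =
    2 ^+ (n.+1 ^ 2) * \prod_(1 <= k < n.+2) (1 - 2 ^- k) :> rat.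
Proof.
rewrite card_GL // card_Fp //.
elim: n.+1 => [|p IHp]; first by rewrite !big_nil.
rewrite !(big_nat_recr p.+1) //= binS bin1 expnD mulnACA natrM IHp.
rewrite natrM natrB ?expn_gt0 // !natrX.
move: (\prod_(_ <= _ < _) _) => P.
have -> : (p.+1 ^ 2 = p ^ 2 + p + p.+1)%N by ring.
rewrite !exprD; field.
by rewrite expf_neq0.
Qed.

Section NumericalBound.
Variable R : realFieldType.

Lemma half_pow_small (k : nat) : 0 < (2 ^- k : R) <= 1.
Proof. by rewrite invr_gt0 invf_le1 ?exprn_gt0 ?exprn_ege1 ?ltr0n ?ler1n. Qed.

Lemma half_prod_gt0 (n : nat) : 0 < \prod_(1 <= k < n.+1) (1 - 2 ^- k) :> R.
Proof.
elim: n => [|n IHn]; first by rewrite big_nil.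
rewrite big_nat_recr //= mulr_gt0 // subr_gt0 invf_lt1 ?exprn_gt0 ?ltr0n //.
by rewrite exprn_egt1 ?ltr1n.
Qed.

Lemma half_prod_anti (n d : nat) :
  \prod_(1 <= k < (d + n).+1) (1 - 2 ^- k) <=
    \prod_(1 <= k < n.+1) (1 - 2 ^- k) :> R.
Proof.
elim: d => // d IHd; rewrite addSn big_nat_recr //=; apply: le_trans IHd.
rewrite ler_piMr ?(ltW (half_prod_gt0 _)) //.
by have := half_pow_small (d + n).+1; lra.
Qed.

(** Writing [x = 2 ^- n], the ratio of [P_n] to its limit expands as
    [1 + x + (2/3) x^2 + ...]; rounding [2/3] up to [1] leaves the room that the
    induction needs.  With [t = 2 ^- n.+1], the step from [n] to [n.+1] is
    [(1 + 2 t + 4 t^2) (1 - t) = 1 + t + 2 t^2 - 4 t^3], which is at least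
    [1 + t + t^2] because [t <= 1/4]. *)
Lemma half_prod_lower (d : nat) :
  1000 / 3463 * (1 + 2 ^- (d + 7) + 4 ^- (d + 7)) <=
    \prod_(1 <= k < (d + 7).+1) (1 - 2 ^- k) :> R.
Proof.
elim: d => [|d IHd].
  rewrite add0n unlock /=; lra.
have step := big_nat_recr (d + 7).+1 1 (fun k => 1 - 2 ^- k : R) isT.
rewrite addSn step {step}; set P := \prod_(_ <= _ < _) _ in IHd *.
have t2 (k : nat) : 4 ^- k = (2 ^- k) ^+ 2 :> R.
  by rewrite exprVn exprAC -(natrX R 2 2).
have tS (k : nat) : 2 ^- k = 2 * 2 ^- k.+1 :> R.
  by rewrite exprS invfM mulrA divff ?mul1r ?pnatr_eq0.
have := half_pow_small (d + 6).
rewrite !t2 (tS (d + 7)%N) in IHd *; rewrite (tS (d + 6)%N) -addnS (tS (d + 7)%N).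
move: (2 ^- _) IHd => t IHd /andP[t0 t1].
have : 1000 / 3463 * (1 + 2 * t + (2 * t) ^+ 2) * (1 - t) <= P * (1 - t).
  by rewrite ler_pM2r //; lra.
apply: le_trans; rewrite -subr_ge0.
rewrite (_ : _ - _ = 1000 / 3463 * (t ^+ 2 * (1 - 4 * t))); last by field.
by rewrite !mulr_ge0 ?sqr_ge0 //; lra.
Qed.

(** The product over [k <= n] dominates the one over [k <= n + 7], where the
    lower bound above is available, so that small [n] need no separate check. *)
Lemma half_prod_inv_lt (n : nat) (a : R) : 0 < a ->
  a * (\prod_(1 <= k < n.+1) (1 - 2 ^- k))^-1 < 3463 / 1000 * a.
Proof.
move=> a0; rewrite mulrC ltr_pM2r // -div1r ltr_pdivrMr ?half_prod_gt0 //.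
have := le_trans (half_prod_lower n) (le_trans _ (half_prod_anti n 7)).
rewrite addnC lexx => /(_ isT).
have : 0 < 4 ^- (7 + n) :> R by rewrite invr_gt0 exprn_gt0 ?ltr0n.
by have := half_pow_small (7 + n); lra.
Qed.

End NumericalBound.

Theorem corollary3p3 (m n : nat) (hm : (2 <= m)%N) (hn : (2 <= n)%N) :
  ((gen m n)%:R <=
     2 ^+ ((m - 1) * n ^ 2) * \prod_(1 <= k < n.+1) (1 - 2 ^- k)^-1 :> rat)
  /\
  (2 ^+ ((m - 1) * n ^ 2) * \prod_(1 <= k < n.+1) (1 - 2 ^- k)^-1
     < (3463 / 1000) * 2 ^+ ((m - 1) * n ^ 2) :> rat).
Proof.
rewrite prodfV; have P0 := half_prod_gt0 rat n; split.
  case: n hn P0 => // n _ P0.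
  have [/admits_matZ_power_GL_bound + _] := genP m (ltn0Sn n).
  rewrite -(ler_nat rat) natrM card_GL2_natr natrX.
  have -> : (m * n.+1 ^ 2 = (m - 1) * n.+1 ^ 2 + n.+1 ^ 2)%N.
    by rewrite -mulSnr subn1 prednK // ltnW.
  rewrite exprD ler_pdivlMr // => le_g.
  by rewrite -(ler_pM2r (exprn_gt0 (n.+1 ^ 2) (ltr0Sn rat 1))) -mulrA [_ * 2 ^+ _]mulrC.
exact: (half_prod_inv_lt rat n _ (exprn_gt0 _ (ltr0Sn rat 1))).
Qed.
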